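(* Let $\kappa_x,\kappa_y,\kappa_z>0$ and $\mathcal L=\kappa_x\mathbb Z\times\kappa_y\mathbb Z\times\kappa_z\mathbb Z$. Any steady state of the form $$V^*=\frac{2\,\mathbf\Gamma\times\mathbf p}{|\mathbf p|^2}\sin(\mathbf p\cdot\mathbf x),\qquad \Omega^*=2\mathbf\Gamma\cos(\mathbf p\cdot\mathbf x),\qquad \mathbf p\in\mathcal L\setminus\{\mathbf 0\},\ \mathbf\Gamma\in\mathbb R^3\setminus\{\mathbf 0\},\ \mathbf p\cdot\mathbf\Gamma=0,$$ of the three-dimensional Euler equations on the torus $[0,2\pi/\kappa_x)\times[0,2\pi/\kappa_y)\times[0,2\pi/\kappa_z)$ is parametrically unstable.
   Context: Parametric instability: a member of the family of steady states $\Omega^*=2\mathbf\Gamma\cos(\mathbf p\cdot\mathbf x)$ (parametrised by $\mathbf p\in\mathcal L\setminus\{\mathbf 0\}$, a discrete parameter, and $\mathbf\Gamma\in\mathbb R^3$ with $\mathbf p\cdot\mathbf\Gamma=0$) is parametrically unstable if by an arbitrarily small perturbation within the family it can be made linearly unstable; that is, for every $\varepsilon>0$ there is $\mathbf\Gamma'$ with $\mathbf p\cdot\mathbf\Gamma'=0$ and $|\mathbf\Gamma'-\mathbf\Gamma|<\varepsilon$ such that the steady state with parameters $\mathbf p,\mathbf\Gamma'$ is linearly unstable. Linear instability: the Euler equations in vorticity form are $\Omega=\nabla\times V$, $\nabla\cdot V=0$, $\partial_t\Omega=(\Omega\cdot\nabla)V-(V\cdot\nabla)\Omega$. In terms of the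 vorticity Fourier modes $\boldsymbol\mu_{\mathbf j}\in\mathbb C^3$, $\mathbf j\in\mathcal L$, of a perturbation of $\Omega^*$ (with $\boldsymbol\mu_{\mathbf 0}=\mathbf 0$), the linearised equations are $$\dot{\boldsymbol\mu}_{\mathbf j}=\chi_+(\mathbf j+\mathbf p)\boldsymbol\mu_{\mathbf j+\mathbf p}+\chi_-(\mathbf j-\mathbf p)\boldsymbol\mu_{\mathbf j-\mathbf p},$$ $$\chi_\pm(\mathbf j)=-\frac{\mathbf j\cdot\mathbf\Gamma}{|\mathbf j|^2}\widehat{\mathbf j}-\frac{(\mathbf p\times\mathbf\Gamma)\mathbf p^{T}}{|\mathbf p|^2}\pm\left(\frac{\mathbf\Gamma(\mathbf j\times\mathbf p)^{T}}{|\mathbf j|^2}+\frac{\mathbf\Gamma\cdot(\mathbf p\times\mathbf j)}{|\mathbf p|^2}I_3\right),$$ where $\widehat{\mathbf j}\,\mathbf b=\mathbf j\times\mathbf b$, restricted to the invariant divergence-free subspace $\mathbf j\cdot\boldsymbol\mu_{\mathbf j}=0$ for all $\mathbf j$. Modes with $\mathbf j$ parallel to $\mathbf p$ are constant. The system decouples into classes: for $\mathbf a\in\mathcal L$ the class led by $\mathbf a$ consists of the modes $\boldsymbol\mu_{\mathbf a+n\mathbf p}$, $n\in\mathbb Z$, and for $\mathbf a$ not parallel to $\mathbf p$ it is generated by a bounded operator on $\ell^2(\mathbb Z;\mathbb C^3)$. A class is linearly stable if, for every divergence-free initial condition with only finitely many nonzero modes, each mode of the solution stays bounded for $t\ge0$;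 otherwise linearly unstable. The steady state is linearly unstable if at least one of its classes is linearly unstable. *)

(* Defs.v *)
From HB Require Import structures.
From mathcomp Require Import all_boot all_order all_algebra complex.
From mathcomp Require Import all_classical all_reals all_analysis.
Set Implicit Arguments.
Unset Strict Implicit.
Unset Printing Implicit Defensive.
Import Order.TTheory GRing.Theory Num.Theory.
Import numFieldNormedType.Exports.
Local Open Scope classical_set_scope.
Local Open Scope ring_scope.

Definition dot (T : comNzRingType) (u v : 'cV[T]_3) : T :=
  \sum_i u i 0 * v i 0.

(* The indices i + 1 and i + 2 are computed in 'I_3, i.e. modulo 3. *)
Definition cross (T : comNzRingType) (u v : 'cV[T]_3) : 'cV[T]_3 :=
  \col_i (u (i + 1) 0 * v (i + 2) 0 - u (i + 2) 0 * v (i + 1) 0).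

(* The matrix of b |-> j x b: its k-th column is j x e_k. *)
Definition hat (T : comNzRingType) (j : 'cV[T]_3) : 'M[T]_3 :=
  \matrix_(i, k) cross j (delta_mx k 0) i 0.

(* Euclidean norms; the library's norm on matrices is the sup norm. *)
Definition enorm (R : realType) (u : 'cV[R]_3) : R := Num.sqrt (dot u u).

Definition cnorm2 (R : realType) (z : 'cV[R[i]]_3) : R :=
  \sum_k (complex.Re (z k 0) ^+ 2 + complex.Im (z k 0) ^+ 2).

Definition cnorm (R : realType) (z : 'cV[R[i]]_3) : R := Num.sqrt (cnorm2 z).

Definition complexify (R : realType) m n (A : 'M[R]_(m, n)) : 'M[R[i]]_(m, n) :=
  map_mx (real_complex R) A.

(* kappa = (kappa_x, kappa_y, kappa_z) *)
Definition lattice (R : realType) (kappa : 'cV[R]_3) : set 'cV[R]_3 :=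
  [set j | exists m : 'cV[int]_3, forall i, j i 0 = kappa i 0 * (m i 0)%:~R].

Record steady_state (R : realType) (kappa : 'cV[R]_3) := SteadyState {
  wavevector : 'cV[R]_3;
  amplitude : 'cV[R]_3;
  wavevector_lattice : lattice kappa wavevector;
  wavevector_neq0 : wavevector != 0;
  wavevector_amplitude : dot wavevector amplitude = 0 }.

(* The flow on the torus with parameters p and Gamma, as periodic fields on
   R^3. The stability notions below depend on it through p and Gamma only. *)
Definition vorticity (R : realType) (kappa : 'cV[R]_3)
    (s : steady_state kappa) (x : 'cV[R]_3) : 'cV[R]_3 :=
  (2 * cos (dot (wavevector s) x)) *: amplitude s.

Definition velocity (R : realType) (kappa : 'cV[R]_3)
    (s : steady_state kappa) (x : 'cV[R]_3) : 'cV[R]_3 :=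
  (2 / dot (wavevector s) (wavevector s) * sin (dot (wavevector s) x))
    *: cross (amplitude s) (wavevector s).

(* chi_+ and chi_- are obtained for e = 1 and e = -1. *)
Definition chi (R : realType) (p Gamma : 'cV[R]_3) (e : R) (j : 'cV[R]_3) :
    'M[R]_3 :=
  - (dot j Gamma / dot j j) *: hat j
  - (dot p p)^-1 *: (cross p Gamma *m p^T)
  + e *: ((dot j j)^-1 *: (Gamma *m (cross j p)^T)
          + (dot Gamma (cross p j) / dot p p)%:M).

(* The modes of the class led by a are indexed by n : int, the n-th one being
   the mode at the following lattice vector. *)
Definition class_mode (R : realType) (p a : 'cV[R]_3) (n : int) : 'cV[R]_3 :=
  a + n%:~R *: p.

(* If a is parallel to p, this vanishes on the divergence-free mode families
   below: the modes are then constant, as they should be. In particular the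
   convention 0^-1 = 0 in chi at the mode 0 is harmless. *)
Definition class_rhs (R : realType) (p Gamma a : 'cV[R]_3)
    (mu : int -> 'cV[R[i]]_3) (n : int) : 'cV[R[i]]_3 :=
  complexify (chi p Gamma 1 (class_mode p a (n + 1))) *m mu (n + 1)
  + complexify (chi p Gamma (-1) (class_mode p a (n - 1))) *m mu (n - 1).

Definition divergence_free (R : realType) (p a : 'cV[R]_3)
    (mu : int -> 'cV[R[i]]_3) : Prop :=
  forall n, dot (complexify (class_mode p a n)) (mu n) = 0
            /\ (class_mode p a n = 0 -> mu n = 0).

(* The squared norm of l^2(Z; C^3). *)
Definition l2norm2 (R : realType) (mu : int -> 'cV[R[i]]_3) : \bar R :=
  (\esum_(n in [set: int]) (cnorm2 (mu n))%:E)%E.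

(* Solutions are differentiable curves in the divergence-free subspace of
   l^2(Z; C^3), with the derivative taken in the l^2 norm; since the generator
   is bounded, there is exactly one for each initial condition. *)
Definition class_solution (R : realType) (p Gamma a : 'cV[R]_3)
    (mu : R -> int -> 'cV[R[i]]_3) : Prop :=
  [/\ forall t, divergence_free p a (mu t),
      forall t, (l2norm2 (mu t) < +oo)%E &
      forall t, l2norm2 (fun n => (h^-1)%:C%C *: (mu (t + h) n - mu t n)
                                  - class_rhs p Gamma a (mu t) n)
                @[h --> 0^'] --> 0%E].

Definition class_linearly_stable (R : realType) (p Gamma a : 'cV[R]_3) : Prop :=
  forall mu0 : int -> 'cV[R[i]]_3,
    divergence_free p a mu0 -> finite_set [set n | mu0 n != 0] ->
  forall mu : R -> int -> 'cV[R[i]]_3,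
    class_solution p Gamma a mu -> mu 0 = mu0 ->
  forall n, exists M : R, forall t, 0 <= t -> cnorm (mu t n) <= M.

Definition linearly_unstable (R : realType) (kappa : 'cV[R]_3)
    (s : steady_state kappa) : Prop :=
  exists2 a, lattice kappa a
    & ~ class_linearly_stable (wavevector s) (amplitude s) a.

Definition parametrically_unstable (R : realType) (kappa : 'cV[R]_3)
    (s : steady_state kappa) : Prop :=
  forall eps : R, 0 < eps -> exists s' : steady_state kappa,
    [/\ wavevector s' = wavevector s,
        enorm (amplitude s' - amplitude s) < eps
      & linearly_unstable s'].

(* Main.v *)
(* The instability is the lift-up mechanism. Rescaled lattice points approximate
   Gamma; projecting such an approximation orthogonally to p gives Gamma' close
   to Gamma and a lattice vector a = s Gamma' + c p with s <> 0. All modes of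
   the class led by a are orthogonal to the direction d = p x Gamma' of the
   basic flow, and chi_+-(j) maps d to a multiple of (j -+ p) x d while it
   annihilates j x d. Hence the generator squares to zero on the mode d placed
   at a, and the solution starting there grows linearly at a + p and a - p. *)
Require Import Defs.
From mathcomp Require Import all_boot all_order all_algebra.
From mathcomp Require Import all_classical all_reals all_analysis.
From mathcomp Require Import complex ring lra.
Set Implicit Arguments.
Unset Strict Implicit.
Unset Printing Implicit Defensive.
Import Order.TTheory GRing.Theory Num.Theory.
Import numFieldNormedType.Exports.
Local Open Scope ring_scope.

(** * Dot and cross product identities in three dimensions *)

Lemma dot3E (T : comNzRingType) (u v : 'cV[T]_3) :
  dot u v = u 0 0 * v 0 0 + u 1 0 * v 1 0 + u 2 0 * v 2 0.
Proof.
rewrite /dot !big_ord_recl big_ord0 addr0 !addrA.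
by congr (_ + u _ _ * v _ _ + u _ _ * v _ _); apply/val_inj.
Qed.

Lemma col3P (T : Type) (u v : 'cV[T]_3) :
  u 0 0 = v 0 0 -> u 1 0 = v 1 0 -> u 2 0 = v 2 0 -> u = v.
Proof.
move=> h0 h1 h2; apply/colP => -[[|[|[|//]]] i3].
- by rewrite (_ : Ordinal i3 = 0) //; apply/val_inj.
- by rewrite (_ : Ordinal i3 = 1) //; apply/val_inj.
- by rewrite (_ : Ordinal i3 = 2) //; apply/val_inj.
Qed.

Lemma cross3E (T : comNzRingType) (u v : 'cV[T]_3) :
  (cross u v 0 0 = u 1 0 * v 2 0 - u 2 0 * v 1 0)
  * (cross u v 1 0 = u 2 0 * v 0 0 - u 0 0 * v 2 0)
  * (cross u v 2 0 = u 0 0 * v 1 0 - u 1 0 * v 0 0).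
Proof.
have e1 : (1 + 1 : 'I_3) = 2 by apply/val_inj.
have e2 : (1 + 2 : 'I_3) = 0 by apply/val_inj.
have e3 : (2 + 1 : 'I_3) = 0 by apply/val_inj.
have e4 : (2 + 2 : 'I_3) = 1 by apply/val_inj.
by rewrite !mxE !add0r !(e1, e2, e3, e4).
Qed.

Ltac by_coordinates :=
  (try apply: col3P); rewrite ?(dot3E, cross3E, mxE); ring.

Section VectorAlgebra.
Variable T : comNzRingType.
Implicit Types u v w : 'cV[T]_3.

Lemma dotC u v : dot u v = dot v u.
Proof. by by_coordinates. Qed.

Lemma dotDl u v w : dot (u + v) w = dot u w + dot v w.
Proof. by by_coordinates. Qed.

Lemma dotZl (k : T) u v : dot (k *: u) v = k * dot u v.
Proof. by by_coordinates. Qed.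

Lemma dotDr u v w : dot u (v + w) = dot u v + dot u w.
Proof. by by_coordinates. Qed.

Lemma dotZr (k : T) u v : dot u (k *: v) = k * dot u v.
Proof. by by_coordinates. Qed.

Lemma dot0r u : dot u 0 = 0.
Proof. by by_coordinates. Qed.

Lemma crossDl u v w : cross (u + v) w = cross u w + cross v w.
Proof. by by_coordinates. Qed.

Lemma crossZl (k : T) u v : cross (k *: u) v = k *: cross u v.
Proof. by by_coordinates. Qed.

Lemma crossDr u v w : cross u (v + w) = cross u v + cross u w.
Proof. by by_coordinates. Qed.

Lemma crossZr (k : T) u v : cross u (k *: v) = k *: cross u v.
Proof. by by_coordinates. Qed.

Lemma cross_self u : cross u u = 0.
Proof. by by_coordinates. Qed.

Lemma crossC u v : cross u v = - cross v u.
Proof. by by_coordinates. Qed.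

Lemma double_cross u v w :
  cross u (cross v w) = dot u w *: v - dot u v *: w.
Proof. by by_coordinates. Qed.

Lemma dot_cross_self u v : dot u (cross u v) = 0.
Proof. by by_coordinates. Qed.

Lemma dot_cross_cross u v :
  dot (cross u v) (cross u v) = dot u u * dot v v - dot u v ^+ 2.
Proof. by by_coordinates. Qed.

Lemma hat_mul u v : hat u *m v = cross u v.
Proof.
apply/colP => i; rewrite mxE.
rewrite -[in RHS](_ : \sum_k v k 0 *: delta_mx k 0 = v); last first.
  apply/colP => k; rewrite summxE (bigD1 k) //= big1 => [|l lk].
    by rewrite !mxE !eqxx addr0 mulr1.
  by rewrite !mxE eq_sym (negbTE lk) mulr0.
have cross0 : cross u 0 = 0 by by_coordinates.
rewrite (big_morph (cross u) (crossDr u) cross0).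
rewrite summxE; apply: eq_bigr => k _.
by rewrite crossZr [LHS]mulrC [hat _ _ _]mxE [RHS]mxE.
Qed.

Lemma outer_mul u v w : u *m v^T *m w = dot v w *: u.
Proof.
rewrite -mulmxA; apply/colP => i; rewrite !mxE big_ord1 mulrC; congr (_ * _).
by rewrite mxE; apply: eq_bigr => k _; rewrite mxE.
Qed.

End VectorAlgebra.

(** * Action of [chi] on the directions [d = p x Gamma] and [j x d] *)

Section RealVectors.
Variable R : realType.
Implicit Types u v p Gamma d j : 'cV[R]_3.

Lemma dot_ge0 u : 0 <= dot u u.
Proof. by apply: sumr_ge0 => i _; rewrite -expr2 sqr_ge0. Qed.

Lemma dot_eq0 u : (dot u u == 0) = (u == 0).
Proof.
apply/idP/eqP => [|->]; last by rewrite dot0r.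
rewrite psumr_eq0 => [/allP u0|i _]; last by rewrite -expr2 sqr_ge0.
apply/colP => i; apply/eqP; rewrite mxE.
by have := u0 i (mem_index_enum _); rewrite /= -expr2 sqrf_eq0.
Qed.

Lemma enorm_gt0 u : (0 < enorm u) = (u != 0).
Proof. by rewrite sqrtr_gt0 lt_neqAle dot_ge0 andbT eq_sym dot_eq0. Qed.

Lemma chi_mul p Gamma (e : R) j v :
  chi p Gamma e j *m v
  = - (dot j Gamma / dot j j) *: cross j v
    - (dot p v / dot p p) *: cross p Gamma
    + e *: ((dot (cross j p) v / dot j j) *: Gamma
            + (dot Gamma (cross p j) / dot p p) *: v).
Proof.
rewrite /chi !(mulmxDl, =^~ scalemxAl, mulNmx) hat_mul !outer_mul.
by rewrite mul_scalar_mx !scalerA ![_^-1 * _]mulrC.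
Qed.

(** As [p . d = 0] and [Gamma . (p x j) = 0], only two terms survive: a multiple of [j x d] and,
    because [j x p = - s d], a multiple of [Gamma]. They merge into one cross product through
    [p x d = - |p|^2 Gamma]. *)
Lemma chi_cross p Gamma (e s c : R) :
  dot p Gamma = 0 ->
  let d := cross p Gamma in
  let j := s *: Gamma + c *: p in
  chi p Gamma e j *m d
    = - (s * dot Gamma Gamma / dot j j) *: cross (j - e *: p) d.
Proof.
move=> pG d j; rewrite chi_mul.
have -> : dot j Gamma = s * dot Gamma Gamma.
  by rewrite dotDl !dotZl pG mulr0 addr0.
have -> : cross j p = - s *: d.
  by rewrite crossDl !crossZl cross_self scaler0 addr0 crossC scalerN scaleNr.
have -> : dot Gamma (cross p j) = 0 by by_coordinates.
have -> : cross (j - e *: p) d = cross j d + (e * dot p p) *: Gamma.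
  rewrite -scaleNr crossDl crossZl (double_cross p p) pG scale0r sub0r.
  by rewrite scalerN scaleNr opprK scalerA.
rewrite dot_cross_self dotZl dot_cross_cross pG expr0n subr0 !mul0r.
rewrite !scale0r addr0 subr0 scalerDr !scalerA; congr (_ + _ *: _); ring.
Qed.

(** The vector [j x p] is parallel to [d], hence orthogonal to [j x d], so the part with the sign
    [e] vanishes. The other two terms are [s |Gamma|^2 d] and its opposite, by
    [j x (j x d) = - |j|^2 d] and [p . (j x d) = s |p|^2 |Gamma|^2]. *)
Lemma chi_cross_cross p Gamma (e s c : R) :
  dot p Gamma = 0 -> p != 0 ->
  let d := cross p Gamma in
  let j := s *: Gamma + c *: p in
  j != 0 -> chi p Gamma e j *m cross j d = 0.
Proof.
move=> pG p0 d j j0; rewrite chi_mul.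
have -> : dot j Gamma = s * dot Gamma Gamma.
  by rewrite dotDl !dotZl pG mulr0 addr0.
have -> : cross j p = - s *: d.
  by rewrite crossDl !crossZl cross_self scaler0 addr0 crossC scalerN scaleNr.
have -> : dot Gamma (cross p j) = 0 by by_coordinates.
have -> : dot p (cross j d) = s * dot p p * dot Gamma Gamma.
  transitivity (s * dot p p * dot Gamma Gamma - s * dot p Gamma ^+ 2).
    by by_coordinates.
  by rewrite pG expr0n mulr0 subr0.
have -> : dot (- s *: d) (cross j d) = 0 by by_coordinates.
have -> : cross j (cross j d) = - dot j j *: d.
  rewrite double_cross (_ : dot j d = 0) ?scale0r ?sub0r ?scaleNr //.
  by by_coordinates.
rewrite !mul0r !scale0r addr0 scaler0 addr0 scalerA -scalerBl.
move: p0 j0; rewrite -(dot_eq0 p) -(dot_eq0 j) => p0 j0.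
rewrite (_ : _ - _ = 0) ?scale0r //; field; exact/andP.
Qed.

End RealVectors.

(** * The linearly growing solution *)

Section LiftUp.
Variable R : realType.
Implicit Types (u v : 'cV[R]_3) (z : 'cV[R[i]]_3).

Lemma cnorm_complexify u : cnorm (complexify u) = enorm u.
Proof.
rewrite /cnorm /enorm; congr Num.sqrt; rewrite /cnorm2 /dot.
by apply: eq_bigr => k _; rewrite mxE /= expr0n addr0 expr2.
Qed.

Lemma enormZ (k : R) u : enorm (k *: u) = `|k| * enorm u.
Proof.
by rewrite /enorm dotZl dotZr mulrA -expr2 sqrtrM ?sqr_ge0// sqrtr_sqr.
Qed.

Lemma dot_complexify u v :
  dot (complexify u) (complexify v) = (dot u v)%:C%C.
Proof.
by rewrite /dot rmorph_sum; apply: eq_bigr => k _; rewrite !mxE rmorphM.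
Qed.

Lemma l2norm2_0 : l2norm2 (fun=> 0 : 'cV[R[i]]_3) = 0%E.
Proof.
apply: esum1 => n _.
by rewrite /cnorm2 big1 // => k _; rewrite mxE expr0n addr0.
Qed.

Lemma l2norm2_finite_support (mu : int -> 'cV[R[i]]_3) :
  finite_set [set n | mu n != 0]%classic -> (l2norm2 mu < +oo)%E.
Proof.
move=> fin_mu; rewrite /l2norm2.
have -> : (\esum_(n in [set: int]) (cnorm2 (mu n))%:E
    = \esum_(n in [set n | (mu n != 0)%R]%classic) (cnorm2 (mu n))%:E)%E.
  rewrite [RHS]esum_mkcond; apply: eq_esum => n _.
  case: ifPn => //; rewrite notin_setE /= => /negP; rewrite negbK => /eqP ->.
  by rewrite /cnorm2 big1 // => k _; rewrite mxE expr0n addr0.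
rewrite esum_fset // => [|n _].
  by rewrite fsumEFin // ltry.
by rewrite lee_fin; apply: sumr_ge0 => k _; rewrite addr_ge0 ?sqr_ge0.
Qed.

Variables p Gamma : 'cV[R]_3.
Variables s c : R.
Hypotheses (pG : dot p Gamma = 0) (p0 : p != 0) (G0 : Gamma != 0) (s0 : s != 0).

Let d := cross p Gamma.
Let a := s *: Gamma + c *: p.
(** The scalar factor of [chi_cross] at [j = a]. *)
Let k := - (s * dot Gamma Gamma / dot a a).

(** The component along [Gamma] survives. Hence no mode of the class sits at the origin, and the
    divisions by [|j|^2] are genuine. *)
Lemma planar_neq0 (b : R) : s *: Gamma + b *: p != 0.
Proof.
apply: contra_neq s0 => /(congr1 (dot Gamma)).
rewrite dotDr !dotZr (dotC Gamma p) pG mulr0 addr0 dot0r => /eqP.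
by rewrite mulf_eq0 dot_eq0 (negbTE G0) orbF => /eqP.
Qed.

Lemma class_modeE n : class_mode p a n = s *: Gamma + (c + n%:~R) *: p.
Proof. by rewrite /class_mode /a -addrA scalerDl. Qed.

Definition lift_source (n : int) : 'cV[R]_3 := (n == 0)%:R *: d.

(** The image of [lift_source] under the generator, supported at [a + p] and [a - p]. *)
Definition lift_growth (n : int) : 'cV[R]_3 :=
  ((n == 1)%:R + (n == -1)%:R) * k *: cross (class_mode p a n) d.

Definition lift_solution (t : R) (n : int) : 'cV[R[i]]_3 :=
  complexify (lift_source n + t *: lift_growth n).

Lemma chi_lift_growth (e : R) n :
  chi p Gamma e (class_mode p a n) *m lift_growth n = 0.
Proof.
by rewrite -scalemxAr class_modeE chi_cross_cross ?scaler0 ?planar_neq0.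
Qed.

Lemma chi_lift_source (e : R) (n : int) :
  chi p Gamma e (class_mode p a n) *m lift_source n
    = ((n == 0)%:R * k) *: cross (a - e *: p) d.
Proof.
rewrite -scalemxAr; case: eqP => [->|_]; last by rewrite mul0r !scale0r.
by rewrite /class_mode scale0r addr0 mul1r scale1r chi_cross.
Qed.

(** Both [chi] matrices kill the part proportional to [t], so the right-hand side is the constant
    velocity of the affine curve [lift_solution]. *)
Lemma class_rhs_lift t n :
  class_rhs p Gamma a (lift_solution t) n = complexify (lift_growth n).
Proof.
rewrite /class_rhs /lift_solution -!map_mxM -map_mxD; congr map_mx.
rewrite !mulmxDr -!(scalemxAr t) !chi_lift_growth !chi_lift_source.
(* The source has index 0, so it is seen through [chi_+] when [n + 1 = 0] and through [chi_-] when
   [n - 1 = 0]. *)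
rewrite !scaler0 !addr0 /lift_growth addr_eq0 subr_eq0 [in RHS]mulrDl.
rewrite scalerDl addrC.
congr (_ + _).
  case: eqP => [->|_]; rewrite ?mul0r ?scale0r // /class_mode.
  by rewrite scaleN1r opprK scale1r.
case: eqP => [->|_]; rewrite ?mul0r ?scale0r // /class_mode.
by rewrite scaleN1r scale1r.
Qed.

Lemma lift_divergence_free t : divergence_free p a (lift_solution t).
Proof.
move=> n; split=> [|]; last first.
  by rewrite class_modeE => /eqP; rewrite (negbTE (planar_neq0 _)).
rewrite dot_complexify dotDr !dotZr dot_cross_self !mulr0 addr0.
rewrite class_modeE dotDl !dotZl dot_cross_self.
by rewrite (_ : dot Gamma d = 0) ?mulr0 ?addr0 ?mulr0 //; by_coordinates.
Qed.

Lemma lift_finite_support t :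
  finite_set [set n | lift_solution t n != 0]%classic.
Proof.
apply: (@sub_finite_set _ _ [set` [:: 0; 1; -1 : int]]%classic); last first.
  exact: finite_seq.
move=> n /=; apply: contraNT; rewrite !inE !negb_or => /and3P[n0 n1 n2].
rewrite /lift_solution /lift_source /lift_growth.
rewrite (negbTE n0) (negbTE n1) (negbTE n2) addr0 mul0r !scale0r scaler0 addr0.
by rewrite /complexify map_mx0.
Qed.

Lemma lift_class_solution : class_solution p Gamma a lift_solution.
Proof.
split=> [||t]; [exact: lift_divergence_free| |].
  by move=> t; apply/l2norm2_finite_support/lift_finite_support.
(* The curve is affine in time: its difference quotient equals the derivative for every [h != 0], so
   the error is exactly 0. *)
apply: cvg_near_cst; near=> h.
rewrite -[RHS]l2norm2_0; congr l2norm2; apply/funext => n.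
rewrite class_rhs_lift /lift_solution -map_mxB.
rewrite [X in map_mx _ X](_ : _ = h *: lift_growth n); last first.
  by rewrite opprD addrACA subrr add0r -scalerBl addrAC subrr add0r.
rewrite map_mxZ scalerA -rmorphM mulVf ?rmorph1 ?scale1r ?subrr //.
near: h; exact: nbhs_dnbhs_neq.
Unshelve. all: by end_near.
Qed.

Lemma class_linearly_unstable : ~ class_linearly_stable p Gamma a.
Proof.
move=> /(_ _ (lift_divergence_free 0) (lift_finite_support 0)
           _ lift_class_solution erefl 1) [M].
(* Here [k != 0], and since [d] is orthogonal to [a + p], the squared norm of [(a + p) x d] is
   [|a + p|^2 |p|^2 |Gamma|^2]. *)
have g0 : 0 < enorm (lift_growth 1).
  rewrite enorm_gt0 scaler_eq0.
  rewrite eqxx addr0 mul1r oppr_eq0 !mulf_eq0 (negbTE s0) dot_eq0 (negbTE G0).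
  rewrite invr_eq0 dot_eq0 (negbTE (planar_neq0 c)) /= -dot_eq0 class_modeE.
  rewrite dot_cross_cross dot_cross_cross pG expr0n subr0.
  rewrite (_ : dot (_ + _) d = 0).
    by rewrite expr0n subr0 !mulf_eq0 !dot_eq0 (negbTE (planar_neq0 _))
               (negbTE p0) (negbTE G0).
  by by_coordinates.
(* At this time the mode at [a + p] has norm [|M| + 1], above the supposed bound; the absolute value
   keeps the time nonnegative. *)
have t0 : 0 <= (`|M| + 1) / enorm (lift_growth 1).
  by rewrite divr_ge0 ?addr_ge0 // ltW.
move=> /(_ _ t0); rewrite cnorm_complexify /lift_source scale0r add0r enormZ.
rewrite (ger0_norm t0) divfK ?gt_eqF // => leM.
by have := ler_norm M; lra.
Qed.

End LiftUp.

(** * Approximation of the amplitude by projected, rescaled lattice points *)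

Section Approximation.
Variable R : realType.

(** Rounding [N v] down to the lattice moves the i-th coordinate by at most [kappa i 0]; dividing by
    [N] leaves an error of at most [|kappa| / N]. *)
Lemma lattice_direction_dense (kappa v : 'cV[R]_3) (eps : R) :
  (forall i, 0 < kappa i 0) -> 0 < eps ->
  exists N : R, exists2 a, lattice kappa a
    & 0 < N /\ enorm (N^-1 *: a - v) < eps.
Proof.
move=> k0 e0.
(* The summand 1 makes [N] positive and [|kappa| / N < eps] strict. *)
pose N : R := enorm kappa / eps + 1.
have N0 : 0 < N by rewrite ltr_wpDl // divr_ge0 ?sqrtr_ge0 ?ltW.
pose m : 'cV[int]_3 := \col_i Num.floor (N * v i 0 / kappa i 0).
exists N; exists (\col_i (kappa i 0 * (m i 0)%:~R)).
  by exists m => i; rewrite mxE.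
split=> //; apply: (@le_lt_trans _ _ (enorm (N^-1 *: kappa))); last first.
  rewrite enormZ gtr0_norm ?invr_gt0 // mulrC ltr_pdivrMr // mulrDr mulr1.
  by rewrite mulrCA divff ?gt_eqF // mulr1 ltrDl.
apply: ler_wsqrtr; apply: ler_sum => i _.
rewrite -!expr2 -[leLHS]real_normK ?num_real // !mxE.
rewrite ler_sqr ?nnegrE ?mulr_ge0 ?invr_ge0 ?(ltW N0) ?(ltW (k0 i)) //.
set x := N * v i 0 / kappa i 0.
have -> : v i 0 = N^-1 * (kappa i 0 * x).
  by rewrite /x [kappa i 0 * _]mulrC divfK ?gt_eqF // mulKf ?gt_eqF.
rewrite -!mulrBr normrM normfV (gtr0_norm N0) ler_pM2l ?invr_gt0 //.
rewrite normrM (gtr0_norm (k0 i)) ler_piMr ?(ltW (k0 i)) // distrC ler_norml.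
by have := floor_itv x; rewrite intrD => /andP[]; lra.
Qed.

(** Orthogonal projection onto the complement of [p]; the identity for [p = 0]. *)
Definition reject (p v : 'cV[R]_3) : 'cV[R]_3 := v - (dot p v / dot p p) *: p.

Lemma dot_reject p v : p != 0 -> dot p (reject p v) = 0.
Proof.
rewrite -dot_eq0 => p0; rewrite /reject -scaleNr dotDr dotZr.
by rewrite mulNr divfK ?subrr.
Qed.

Lemma reject_orthogonal p v : dot p v = 0 -> reject p v = v.
Proof. by move=> pv; rewrite /reject pv mul0r scale0r subr0. Qed.

Lemma rejectB p u v : reject p (u - v) = reject p u - reject p v.
Proof.
rewrite /reject -scaleN1r dotDr dotZr.
by apply/colP => i; rewrite !mxE; ring.
Qed.

(** By Pythagoras, the projection removes [(p . v)^2 / |p|^2] from the squared norm. *)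
Lemma enorm_reject_le p v : enorm (reject p v) <= enorm v.
Proof.
have [->|p0] := eqVneq p 0; first by rewrite /reject scaler0 subr0.
apply: ler_wsqrtr; move: (p0); rewrite -dot_eq0 => pp.
have -> : dot (reject p v) (reject p v) = dot v v - dot p v ^+ 2 / dot p p.
  rewrite {2}/reject -scaleNr dotDr dotZr (dotC (reject p v) p).
  rewrite dot_reject // mulr0 addr0 (dotC _ v).
  by rewrite /reject -scaleNr dotDr dotZr (dotC v p); ring.
by rewrite gerBl divr_ge0 ?sqr_ge0 ?dot_ge0.
Qed.

End Approximation.

Theorem theorem5p4 (R : realType) (kappa : 'cV[R]_3)
    (hkappa : forall i, 0 < kappa i 0)
    (s : steady_state kappa) (hs : amplitude s != 0) :
  parametrically_unstable s.
Proof.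
move=> eps eps0; case: s hs => p Gamma pL p0 pG /= G0.
have nG0 : 0 < enorm Gamma by rewrite enorm_gt0.
(* Closeness below [|Gamma|] will force the perturbed amplitude to be nonzero. *)
have de0 : 0 < Num.min eps (enorm Gamma) by rewrite lt_min eps0.
have [N [a aL [N0 aG]]] := lattice_direction_dense Gamma hkappa de0.
pose G := reject p (N^-1 *: a).
have pG' : dot p G = 0 by exact: dot_reject.
have close : enorm (G - Gamma) < Num.min eps (enorm Gamma).
  (* [Gamma] is its own projection, so projecting the approximation does not increase its error. *)
  apply: le_lt_trans aG; rewrite -[X in enorm (_ - X)](reject_orthogonal pG).
  by rewrite -rejectB enorm_reject_le.
move: close; rewrite lt_min => /andP[Geps GGamma].
have G0' : G != 0.
  apply: contraTneq GGamma => ->; rewrite sub0r -scaleN1r enormZ.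
  by rewrite normrN normr1 mul1r ltxx.
exists (SteadyState pL p0 pG'); split=> //=; exists a => //=.
(* Undoing the projection and the rescaling puts [a] in the span of [G] and [p], with the nonzero
   coefficient [N] on [G]. *)
have -> : a = N *: G + (N * (dot p (N^-1 *: a) / dot p p)) *: p.
  rewrite /G /reject -(scalerA N) -scalerDr subrK scalerA divff ?gt_eqF //.
  by rewrite scale1r.
by apply: class_linearly_unstable; rewrite ?gt_eqF.
Qed.
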